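(* For every integer $n\geq 4$, the set $\Sigma_{n,6}$ contains a form that is positive definite and noncoercive.
   Context: A form is a homogeneous polynomial; all polynomials are taken to be forms. $\Sigma_{n,d}$ ($d$ even) denotes the set of all forms $f\in\mathbb{R}[x_1,\ldots,x_n]$ of degree $d$ that are sums of squares, i.e. for which there exist $p_1,\ldots,p_r\in\mathbb{R}[x_1,\ldots,x_n]$ with $f=\sum_{j=1}^r p_j^2$. A form $f$ is positive definite if $f(\mathbf{a})>0$ for all $\mathbf{a}\in\mathbb{R}^n\setminus\{\mathbf{0}\}$. A sum of squares $f\in\mathbb{R}[x_1,\ldots,x_n]$ is called noncoercive if for every representation $f=\sum_{j=1}^r p_j^2$ with $p_1,\ldots,p_r\in\mathbb{R}[x_1,\ldots,x_n]$ the system $p_1=\cdots=p_r=0$ has a solution $\mathbf{a}\in\mathbb{C}^n\setminus\{\mathbf{0}\}$. *)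

(* Defs.v *)
From mathcomp Require Import all_boot all_order all_algebra.
From mathcomp Require Import complex mpoly reals.

Set Implicit Arguments.
Unset Strict Implicit.
Unset Printing Implicit Defensive.

Import Order.TTheory GRing.Theory Num.Theory.
Local Open Scope ring_scope.

Section SumsOfSquares.
Variables (R : realType) (n : nat).
Implicit Types (f : {mpoly R[n]}).

Definition sos_rep f r (p : 'I_r -> {mpoly R[n]}) : Prop :=
  f = \sum_(j < r) p j ^+ 2.

(* Sigma_{n,d}. The p_j range over all of R[x_1,...,x_n]: when f is a form of
   degree d, they are forced to be forms of degree d/2. *)
Definition Sigma d f : Prop :=
  f \is d.-homog /\ exists r (p : 'I_r -> {mpoly R[n]}), sos_rep f p.

Definition positive_definite f : Prop :=
  forall a : 'I_n -> R, (exists i, a i != 0) -> 0 < f.@[a].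

(* Meaningful for sums of squares f only; vacuously true of other polynomials. *)
Definition noncoercive f : Prop :=
  forall r (p : 'I_r -> {mpoly R[n]}), sos_rep f p ->
  exists2 a : 'I_n -> R[i], (exists i, a i != 0) &
    forall j, (map_mpoly (real_complex R) (p j)).@[a] = 0.

End SumsOfSquares.

(* Main.v *)
Require Import Defs.
From mathcomp Require Import all_boot all_order all_algebra.
From mathcomp Require Import complex mpoly reals.
From mathcomp Require Import zify ring lra.

Set Implicit Arguments.
Unset Strict Implicit.
Unset Printing Implicit Defensive.

Import Order.TTheory GRing.Theory Num.Theory.
Local Open Scope ring_scope.

(** Fix distinct indices z and w, let s be the sum of the squares of all the
    other variables, and let f = F(s, z^2, w^2) where

      F(X, Y, Z) = X (X - 3/4 (Y + Z))^2 + Y (Y - 3/4 (X + Z))^2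
                   + Z (Z - 3/4 (X + Y))^2.

    Since s is itself a sum of squares, f is a sum of squares of cubics.  It is
    positive definite because the three products in F do not vanish together
    on the nonnegative orthant, except at the origin ([sextic_gt0]).  Every sum
    of squares representation of f vanishes at the complex point e_x + i e_y,
    for any two further indices x and y.  There are two reasons.

    First, the ternary sextic F(r^2, z^2, w^2) lies on the boundary of the cone
    of sums of squares.  A combination of point evaluations, [separator], kills
    this sextic, and on squares of cubics it is itself a sum of squares of
    linear forms in the coefficients ([separator_square]).  So every cubic q
    occurring in a representation of the sextic satisfies the linear equations
    thus obtained; among them is

      3 [r^3] q + 4 [r z^2] q = 0            ([sextic_sos_kernel]).

    Secondly, f contains many copies of this sextic.  For each real unit vector
    e supported off z and w, restricting f to the span of e, e_z and e_w gives
    F(r^2, z^2, w^2), so each cubic p of a representation of f satisfies the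
    above equation on each slice.  Now [r^3] is p(e), a cubic form in e, while
    [r z^2] is a linear form in e.  Hence p agrees on the unit sphere with a
    linear form l, that is, p = l |.|^2 on the span of e_x and e_y.  The
    quadratic form |.|^2 = x^2 + y^2 is zero at e_x + i e_y, and so is p.

    All this needs the terms of a representation to be cubic forms; that is
    [sos_homog].  Slices are computed with a trilinear map that restricts to p
    on the diagonal ([homog3_cubic_form], [meval_cubic_form]). *)

(** * Sums of squares of degree 2d have terms of degree d *)

Lemma seq_maximum (T : eqType) (le : rel T) (s : seq T) (x : T) :
  total le -> transitive le -> x \in s ->
  exists2 m, m \in s & {in s, forall y, le y m}.
Proof.
move=> le_total le_trans; have le_refl y : le y y by rewrite -[le y y]orbb.
elim: s x => // a [|b s] IHs x _.
  by exists a; rewrite ?mem_head // => y; rewrite inE => /eqP->.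
have [m m_s maxm] := IHs b (mem_head _ _).
case/orP: (le_total m a) => [le_ma|le_am].
  exists a; rewrite ?mem_head // => y; rewrite in_cons => /orP[/eqP->//|/maxm].
  by move=> /le_trans; apply.
exists m; first by rewrite in_cons m_s orbT.
by move=> y; rewrite in_cons => /orP[/eqP->//|/maxm].
Qed.

(** If [m] is extreme among the monomials of [p], then [m + m] is a sum of two
    of these monomials in only one way. *)
Lemma mcoeff_square_extreme (R : comNzRingType) n (le : rel 'X_{1..n})
    (p : {mpoly R[n]}) (m : 'X_{1..n}) :
  (forall m1 m2, le m1 m -> le m2 m -> (m1 + m2 = m + m)%MM -> m1 = m) ->
  {in msupp p, forall m', le m' m} ->
  (p ^+ 2)@_(m + m) = p@_m ^+ 2.
Proof.
move=> extm lepm; rewrite expr2 mcoeffM.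
have ltm : (mdeg m < (mdeg (m + m)%MM).+1)%N by rewrite mdegD ltnS leq_addr.
rewrite (bigD1 (BMultinom ltm, BMultinom ltm)) //= big1 ?addr0 ?expr2 //.
case=> [[m1 ltm1] [m2 ltm2]] /= /andP[/eqP def_mm ne_mm].
have [->|p1] := eqVneq p@_m1 0; first by rewrite mul0r.
have [->|p2] := eqVneq p@_m2 0; first by rewrite mulr0.
have le1 : le m1 m by apply: lepm; rewrite mcoeff_msupp.
have le2 : le m2 m by apply: lepm; rewrite mcoeff_msupp.
have e1 : m1 = m := extm m1 m2 le1 le2 (esym def_mm).
have e2 : m2 = m by apply: (extm m2 m1) => //; rewrite addmC -def_mm.
by case/negP: ne_mm; rewrite xpair_eqE -!val_eqE /= e1 e2 eqxx.
Qed.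

(** At twice a monomial that is extreme among all those of the [p j], the sum of
    squares has a sum of squares of real coefficients, not all zero, as its
    coefficient, so nothing cancels.  The graded monomial order thus bounds the
    degrees from above, and its reverse bounds them from below. *)
Lemma sos_homog (R : realFieldType) n d r (p : 'I_r -> {mpoly R[n]}) :
  \sum_(j < r) p j ^+ 2 \is (d + d)%N.-homog -> forall j, p j \is d.-homog.
Proof.
set f := \sum_(j < r) _ => f_homog.
pose S := flatten [seq msupp (p j) | j <- enum 'I_r].
have mem_S m j : m \in msupp (p j) -> m \in S.
  by move=> pm; apply/flatten_mapP; exists j; rewrite ?mem_enum.
have extreme (le : rel 'X_{1..n}) m0 : total le -> transitive le ->
    (forall m m1 m2, le m1 m -> le m2 m -> (m1 + m2 = m + m)%MM -> m1 = m) ->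
    m0 \in S -> exists2 m, le m0 m & mdeg m = d.
  move=> le_total le_trans le_ext S_m0.
  have [m S_m maxm] := seq_maximum le_total le_trans S_m0.
  exists m; first exact: maxm.
  apply/eqP; apply: contraTT S_m => ne_d; apply/negP => /flatten_mapP[j _ pm].
  have f_mm : f@_(m + m) = \sum_(j < r) (p j)@_m ^+ 2.
    rewrite raddf_sum; apply: eq_bigr => i _.
    apply: (mcoeff_square_extreme (le := le)); first exact: le_ext.
    by move=> m' pm'; apply/maxm/(mem_S _ i).
  have: f@_(m + m) = 0.
    by apply: (dhomog_nemf_coeff f_homog); rewrite /= mdegD; lia.
  rewrite f_mm => /eqP; rewrite psumr_eq0 => [|i _]; last exact: sqr_ge0.
  move=> /allP/(_ j (mem_index_enum _)).
  by rewrite /= sqrf_eq0 => /eqP pm0; rewrite mcoeff_msupp pm0 eqxx in pm.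
move=> j; apply/dhomogP => m0 /mem_S S_m0 /=; apply/eqP.
rewrite eqn_leq; apply/andP; split.
- have [||||m lem <-] := extreme (fun a b => a <= b)%O m0 => //.
  + by move=> b a c; apply: le_trans.
  + move=> m m1 m2 le1 le2 e; apply/eqP; apply: contra_eqT e => ne.
    by rewrite lt_eqF // ltmc_le_add // lt_neqAle ne.
  + exact: lemc_mdeg.
- have [||||m lem <-] := extreme (fun a b => b <= a)%O m0 => //.
  + by move=> a b c ba cb; apply: le_trans cb ba.
  + move=> m m1 m2 le1 le2 e; apply/eqP; apply: contra_eqT e => ne.
    by rewrite gt_eqF // ltmc_le_add // lt_neqAle eq_sym ne.
  + exact: lemc_mdeg.
Qed.

(** * Cubic forms and trilinear maps *)

Lemma mdegS_split n d (m : 'X_{1..n}) :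
  mdeg m = d.+1 -> exists i m', mdeg m' = d /\ m = (U_(i) + m')%MM.
Proof.
move=> deg_m; have [i mi|m0] := pickP (fun i => m i != 0%N); last first.
  suff m_0 : m = 0%MM by rewrite m_0 mdeg0 in deg_m.
  by apply/mnmP => i; rewrite mnm0E; apply/eqP/negPn; rewrite m0.
have e : m = (U_(i) + (m - U_(i)))%MM by rewrite addmC submK // lep1mP.
exists i, (m - U_(i))%MM; split => //.
by move: deg_m; rewrite {1}e mdegD mdeg1 add1n => -[].
Qed.

Section Trilinear.
Variables (R : comNzRingType) (n : nat).
Implicit Types (s : seq (R * ('I_n * 'I_n * 'I_n))) (u v w : 'I_n -> R).

(** Each monomial comes with an arbitrary order of its three variables, so
    [trilin] below depends on [s] and is not symmetric.  This is harmless: only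
    sums over all positions of the arguments occur. *)
Definition cubic_form s : {mpoly R[n]} :=
  \sum_(q <- s) q.1 *: ('X_q.2.1.1 * 'X_q.2.1.2 * 'X_q.2.2).

Definition trilin s u v w : R :=
  \sum_(q <- s) q.1 * (u q.2.1.1 * v q.2.1.2 * w q.2.2).

Definition comb a u b v c w : 'I_n -> R := fun i => a * u i + b * v i + c * w i.

Lemma homog3_cubic_form (p : {mpoly R[n]}) :
  p \is 3.-homog -> exists s, p = cubic_form s.
Proof.
move=> p_homog; rewrite [p]mpolyE big_seq.
elim/big_rec: _ => [|m q pm [s ->]].
  by exists [::]; rewrite /cubic_form big_nil.
have /= deg_m := dhomogP _ _ _ p_homog m pm.
have [i [m1 [deg_m1 ->]]] := mdegS_split deg_m.
have [j [m2 [/eqP/mdeg1P[k /eqP->] ->]]] := mdegS_split deg_m1.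
exists ((p@_(U_(i) + (U_(j) + U_(k))), (i, j, k)) :: s).
by rewrite /cubic_form big_cons /= !mpolyXD mulrA.
Qed.

Lemma meval_cubic_form s u : (cubic_form s).@[u] = trilin s u u u.
Proof.
rewrite raddf_sum; apply: eq_bigr => q _ /=.
by rewrite mevalZ !mevalM !mevalXU.
Qed.

Lemma meval_map_cubic_form (S : comNzRingType) (f : {rmorphism R -> S}) s
    (a : 'I_n -> S) :
  (map_mpoly f (cubic_form s)).@[a] =
  \sum_(q <- s) f q.1 * (a q.2.1.1 * a q.2.1.2 * a q.2.2).
Proof.
rewrite (raddf_sum (map_mpoly f)) raddf_sum; apply: eq_bigr => q _ /=.
by rewrite map_mpolyZ !rmorphM /= !map_mpolyX mevalZ !mevalM !mevalXU.
Qed.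

Lemma trilin_comb1 s a u b v c w x y :
  trilin s (comb a u b v c w) x y =
  a * trilin s u x y + b * trilin s v x y + c * trilin s w x y.
Proof.
rewrite !mulr_sumr -!big_split; apply: eq_bigr => q _ /=.
by rewrite /comb; ring.
Qed.

Lemma trilin_comb2 s a u b v c w x y :
  trilin s x (comb a u b v c w) y =
  a * trilin s x u y + b * trilin s x v y + c * trilin s x w y.
Proof.
rewrite !mulr_sumr -!big_split; apply: eq_bigr => q _ /=.
by rewrite /comb; ring.
Qed.

Lemma trilin_comb3 s a u b v c w x y :
  trilin s x y (comb a u b v c w) =
  a * trilin s x y u + b * trilin s x y v + c * trilin s x y w.
Proof.
rewrite !mulr_sumr -!big_split; apply: eq_bigr => q _ /=.
by rewrite /comb; ring.
Qed.

Definition trilin_comb := (trilin_comb1, trilin_comb2, trilin_comb3).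

End Trilinear.

Local Open Scope complex_scope.

(** This expands [T (x + i y) (x + i y) (x + i y)] by trilinearity. *)
Lemma meval_cubic_form_complex (R : rcfType) n
    (s : seq (R * ('I_n * 'I_n * 'I_n))) (x y : 'I_n -> R) :
  let T := trilin s in
  (map_mpoly (real_complex R) (cubic_form s)).@[fun i => x i +i* y i] =
  (T x x x - T x y y - T y x y - T y y x) +i*
  (T x x y + T x y x + T y x x - T y y y).
Proof.
rewrite /= meval_map_cubic_form /trilin; elim: s => [|q s IHs].
  by rewrite !big_nil !subr0 !addr0.
rewrite !big_cons IHs /=.
by apply/eqP; rewrite eq_complex /=; apply/andP; split; apply/eqP; ring.
Qed.

(** * A ternary sextic on the boundary of the sums of squares *)

Section Ternary.
Variable R : realFieldType.
Implicit Types (x y z : R) (g : R -> R -> R -> R).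

Definition sextic (X Y Z : R) : R :=
  X * (X - 3 / 4 * (Y + Z)) ^+ 2 + Y * (Y - 3 / 4 * (X + Z)) ^+ 2 +
  Z * (Z - 3 / 4 * (X + Y)) ^+ 2.

(** If the sextic vanishes, then each variable is zero or 3/4 times the sum of
    the other two.  When k of the variables are nonzero, summing over these
    gives S = 3/4 (k - 1) S for their sum S, and S = 0 since 3/4 (k - 1) is 0,
    3/4 or 3/2 for k = 1, 2, 3. *)
Lemma sextic_gt0 X Y Z : 0 <= X -> 0 <= Y -> 0 <= Z ->
  (X != 0) || (Y != 0) || (Z != 0) -> 0 < sextic X Y Z.
Proof.
move=> X0 Y0 Z0.
have term0 (A B : R) : 0 <= A -> 0 <= A * B ^+ 2.
  by move=> A0; rewrite mulr_ge0 ?sqr_ge0.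
rewrite lt_neqAle !addr_ge0 ?term0 // andbT; apply: contraTN => /eqP/esym/eqP.
rewrite !paddr_eq0 ?addr_ge0 ?term0 // !mulf_eq0 ?orbb.
rewrite !negb_or !negbK.
by move=> /andP[/andP[/orP[]/eqP ? /orP[]/eqP ?] /orP[]/eqP ?];
  rewrite -andbA; apply/and3P; split; apply/eqP; lra.
Qed.

(** On even sextics this is the symmetric functional with values 9, 6 and 2 at
    x^6, x^4 y^2 and x^2 y^2 z^2.  These moments make x (4 x^2 - 3 (y^2 + z^2))
    and its two permutations orthogonal to all cubics; up to a scalar, these
    are the terms of the sextic.  The negative weights at the unit vectors show
    that it is no positive measure, as it must not be in order to kill a
    positive form. *)
Definition separator g : R :=
  (g 1 1 1 + g 1 1 (-1) + g 1 (-1) 1 + g (-1) 1 1) / 2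
  + 2 * (g 1 1 0 + g 1 (-1) 0 + g 1 0 1 + g 1 0 (-1) + g 0 1 1 + g 0 1 (-1))
  - (g 1 0 0 + g 0 1 0 + g 0 0 1).

Lemma separator_sextic :
  separator (fun x y z => sextic (x ^+ 2) (y ^+ 2) (z ^+ 2)) = 0.
Proof. by rewrite /separator /sextic; field. Qed.

Lemma separator_sum r (g : 'I_r -> R -> R -> R -> R) :
  separator (fun x y z => \sum_(j < r) g j x y z) =
  \sum_(j < r) separator (g j).
Proof.
by rewrite /separator !(big_split, sumrN, =^~ mulr_suml, =^~ mulr_sumr) /=.
Qed.

(** The coefficients are grouped by the parities of the exponents: monomials of
    different groups are orthogonal for [separator]. *)
Definition ternary_cubic (a b c d e f g h k l x y z : R) : R :=
  a * x ^+ 3 + b * x * y ^+ 2 + c * x * z ^+ 2 +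
  d * y ^+ 3 + e * y * x ^+ 2 + f * y * z ^+ 2 +
  g * z ^+ 3 + h * z * x ^+ 2 + k * z * y ^+ 2 + l * x * y * z.

(** Each group of three monomials has the Gram matrix with rows (9, 6, 6),
    (6, 6, 2), (6, 2, 6), which is positive semidefinite of rank 2. *)
Lemma separator_square (a b c d e f g h k l : R) :
  separator (fun x y z => ternary_cubic a b c d e f g h k l x y z ^+ 2) =
  (3 * a + 2 * (b + c)) ^+ 2 + 2 * (b - c) ^+ 2 +
  (3 * d + 2 * (e + f)) ^+ 2 + 2 * (e - f) ^+ 2 +
  (3 * g + 2 * (h + k)) ^+ 2 + 2 * (h - k) ^+ 2 + 2 * l ^+ 2.
Proof. by rewrite /separator /ternary_cubic; field. Qed.

(** The functional is nonnegative on each square and zero on their sum, hence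
    zero on each square; the first two squares of [separator_square] then give
    [b j = c j] and [3 * a j + 2 * (b j + c j) = 0]. *)
Lemma sextic_sos_kernel r (a b c d e f g h k l : 'I_r -> R) :
  (forall x y z, \sum_(j < r) ternary_cubic (a j) (b j) (c j) (d j) (e j)
     (f j) (g j) (h j) (k j) (l j) x y z ^+ 2 =
     sextic (x ^+ 2) (y ^+ 2) (z ^+ 2)) ->
  forall j, 3 * a j + 4 * b j = 0.
Proof.
move=> sosF j; pose q i x y z := ternary_cubic (a i) (b i) (c i) (d i) (e i)
     (f i) (g i) (h i) (k i) (l i) x y z ^+ 2.
have sep0 : \sum_(i < r) separator (q i) = 0.
  rewrite -separator_sum -[RHS]separator_sextic /separator.
  by congr (_ / 2 + 2 * _ - _); rewrite !sosF.
have sep_ge0 i : 0 <= separator (q i).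
  by rewrite separator_square !addr_ge0 // ?sqr_ge0 // mulr_ge0 ?sqr_ge0.
move/eqP: sep0; rewrite psumr_eq0 => [|i _]; last exact: sep_ge0.
move=> /allP/(_ j (mem_index_enum _)) /=; rewrite separator_square.
have sq2_ge0 (t : R) : 0 <= 2 * t ^+ 2 by rewrite mulr_ge0 ?sqr_ge0.
rewrite !paddr_eq0 ?addr_ge0 ?sq2_ge0 ?sqr_ge0 // !mulf_eq0 ?orbb !pnatr_eq0 /=.
move=> /andP[/andP[/andP[/andP[/andP[/andP[/eqP a0 /eqP bc] _] _] _] _] _].
by lra.
Qed.

End Ternary.

(** * The form in n variables *)

Section RotatedSextic.
Variables (R : realFieldType) (n : nat) (z w : 'I_n).

Definition sqnorm_off : {mpoly R[n]} :=
  \sum_(i | (i != z) && (i != w)) 'X_i ^+ 2.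

Definition factor i : {mpoly R[n]} :=
  if i == z then 'X_z ^+ 2 - (3 / 4) *: (sqnorm_off + 'X_w ^+ 2)
  else if i == w then 'X_w ^+ 2 - (3 / 4) *: (sqnorm_off + 'X_z ^+ 2)
  else sqnorm_off - (3 / 4) *: ('X_z ^+ 2 + 'X_w ^+ 2).

(** The product s (s - 3/4 (z^2 + w^2))^2 is spread over the variables of s,
    which makes the whole form a sum of squares of cubics. *)
Definition rotated_sextic : {mpoly R[n]} := \sum_(i < n) ('X_i * factor i) ^+ 2.

Lemma rotated_sextic_homog : rotated_sextic \is 6.-homog.
Proof.
have X1 i : 'X_i \is [in R[n], 1.-homog] by rewrite dhomogX /= mdeg1.
have X2 i : 'X_i ^+ 2 \is [in R[n], 2.-homog] by apply: (dhomogMn 2 (X1 i)).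
have S2 : sqnorm_off \is 2.-homog by apply: rpred_sum => i _.
apply: rpred_sum => i _; apply: (dhomogMn 2 (d := 3)).
apply: (dhomogM (d := 1) (e := 2)) => //; rewrite /factor.
by do 2?case: ifP => _; rewrite rpredB ?rpredZ ?rpredD.
Qed.

Hypothesis zw : z != w.

Lemma meval_rotated_sextic a : rotated_sextic.@[a] =
  sextic (\sum_(i | (i != z) && (i != w)) a i ^+ 2) (a z ^+ 2) (a w ^+ 2).
Proof.
have evS : sqnorm_off.@[a] = \sum_(i | (i != z) && (i != w)) a i ^+ 2.
  by rewrite raddf_sum; apply: eq_bigr => i _; rewrite /= rmorphXn /= mevalXU.
rewrite raddf_sum (bigD1 z) //= (bigD1 w) 1?eq_sym //=.
rewrite (eq_bigr (fun i => a i ^+ 2 *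
    (sqnorm_off.@[a] - 3 / 4 * (a z ^+ 2 + a w ^+ 2)) ^+ 2)); last first.
  move=> i /andP[/negPf iz /negPf iw]; rewrite /factor iz iw.
  rewrite rmorphXn /= mevalM exprMn mevalXU mevalB mevalZ mevalD.
  by rewrite !rmorphXn /= !mevalXU.
rewrite -mulr_suml -evS /factor !eqxx [w == z]eq_sym (negPf zw).
rewrite !rmorphXn /= !mevalM !mevalXU !(mevalB, mevalZ, mevalD).
rewrite !rmorphXn /= !mevalXU.
by rewrite /sextic; ring.
Qed.

Lemma rotated_sextic_positive_definite a :
  (exists i, a i != 0) -> 0 < rotated_sextic.@[a].
Proof.
case=> i ai; rewrite meval_rotated_sextic sextic_gt0 ?sqr_ge0 //.
  by apply: sumr_ge0 => k _; apply: sqr_ge0.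
have [<-|iz] := eqVneq i z; first by rewrite !sqrf_eq0 ai orbT.
have [<-|iw] := eqVneq i w; first by rewrite !sqrf_eq0 ai orbT.
rewrite psumr_neq0 => [|k _]; last exact: sqr_ge0.
apply/orP; left; apply/orP; left; apply/hasP.
exists i; rewrite ?mem_index_enum //.
by rewrite iz iw /= lt_def sqrf_eq0 ai sqr_ge0.
Qed.

Definition basis_vector (k : 'I_n) : 'I_n -> R := fun i => (i == k)%:R.

(** The equation of [sextic_sos_kernel] on the slice spanned by [e],
    [basis_vector z] and [basis_vector w]: the first summand is the coefficient
    of r^3 and the second that of r z^2. *)
Lemma sos_rotated_sextic_slice r
    (s : 'I_r -> seq (R * ('I_n * 'I_n * 'I_n))) e :
  rotated_sextic = \sum_(j < r) cubic_form (s j) ^+ 2 ->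
  e z = 0 -> e w = 0 -> \sum_(i < n) e i ^+ 2 = 1 ->
  forall j, let T := trilin (s j) in let dz := basis_vector z in
  3 * T e e e + 4 * (T e dz dz + T dz e dz + T dz dz e) = 0.
Proof.
move=> sosf ez ew e1 j T0 dz; rewrite {}/T0; pose dw := basis_vector w.
pose T j := trilin (s j).
apply: (@sextic_sos_kernel _ _ (fun j => T j e e e)
  (fun j => T j e dz dz + T j dz e dz + T j dz dz e)
  (fun j => T j e dw dw + T j dw e dw + T j dw dw e)
  (fun j => T j dz dz dz)
  (fun j => T j dz e e + T j e dz e + T j e e dz)
  (fun j => T j dz dw dw + T j dw dz dw + T j dw dw dz)
  (fun j => T j dw dw dw)
  (fun j => T j dw e e + T j e dw e + T j e e dw)
  (fun j => T j dw dz dz + T j dz dw dz + T j dz dz dw)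
  (fun j => T j e dz dw + T j e dw dz + T j dz e dw + T j dz dw e
          + T j dw e dz + T j dw dz e)) => x y t.
have := meval_rotated_sextic (comb x e y dz t dw).
have -> : \sum_(i | (i != z) && (i != w)) comb x e y dz t dw i ^+ 2 = x ^+ 2.
  rewrite -[RHS]mulr1 -e1 [in RHS](bigD1 z) //= [in RHS](bigD1 w) 1?eq_sym //=.
  rewrite ez ew expr0n !add0r mulr_sumr.
  apply: eq_bigr => i /andP[/negPf iz /negPf iw].
  by rewrite /comb /dz /dw /basis_vector iz iw /=; ring.
have vz : comb x e y dz t dw z = y.
  by rewrite /comb /dz /dw /basis_vector eqxx (negPf zw) ez /=; ring.
have vw : comb x e y dz t dw w = t.
  by rewrite /comb /dz /dw /basis_vector eqxx eq_sym (negPf zw) ew /=; ring.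
rewrite vz vw => <-.
rewrite sosf raddf_sum; apply: eq_bigr => i _.
rewrite [RHS]rmorphXn /= meval_cubic_form -/(T i) -/dz -/dw; congr (_ ^+ 2).
by rewrite /T !trilin_comb /ternary_cubic; ring.
Qed.

End RotatedSextic.

(** On the plane of e_x and e_y, write p = A x^3 + B x^2 y + C x y^2 + D y^3.
    The value at e_x + i e_y is (A - C) + i (B - D), and the slices show that
    A = C and B = D, which means that x^2 + y^2 divides p there. *)
Lemma rotated_sextic_noncoercive (R : realType) n (z w x y : 'I_n) :
  uniq [:: z; w; x; y] -> noncoercive (rotated_sextic R z w).
Proof.
rewrite /= !inE !negb_or => /and4P[/and3P[zw zx zy] /andP[wx wy] xy _] r p sosf.
have p_homog := @sos_homog _ _ 3 _ p.
rewrite -[X in X \is _]sosf in p_homog.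
have [s def_p] : exists s, forall j, p j = cubic_form (s j).
  apply: (fin_all_exists (P := fun j s => p j = cubic_form s)) => j.
  exact/homog3_cubic_form/p_homog/rotated_sextic_homog.
have {}sosf : rotated_sextic R z w = \sum_(j < r) cubic_form (s j) ^+ 2.
  by rewrite sosf; apply: eq_bigr => j _; rewrite def_p.
pose dx := @basis_vector R n x; pose dy := @basis_vector R n y.
pose T j := trilin (s j).
pose dz := @basis_vector R n z.
pose L j e := T j e dz dz + T j dz e dz + T j dz dz e.
have slice c d : c ^+ 2 + d ^+ 2 = 1 -> forall j,
    3 * (c ^+ 3 * T j dx dx dx
         + c ^+ 2 * d * (T j dx dx dy + T j dx dy dx + T j dy dx dx)
         + c * d ^+ 2 * (T j dx dy dy + T j dy dx dy + T j dy dy dx)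
         + d ^+ 3 * T j dy dy dy) + 4 * (c * L j dx + d * L j dy) = 0.
  move=> cd1 j; pose e := comb c dx d dy 0 dx.
  have ez : e z = 0.
    by rewrite /e /comb /dx /dy /basis_vector (negPf zx) (negPf zy) /=; ring.
  have ew : e w = 0.
    by rewrite /e /comb /dx /dy /basis_vector (negPf wx) (negPf wy) /=; ring.
  have e1 : \sum_(i < n) e i ^+ 2 = 1.
    rewrite -cd1 (bigD1 x) //= (bigD1 y) 1?eq_sym //= big1.
      rewrite /e /comb /dx /dy /basis_vector !eqxx [y == x]eq_sym (negPf xy) /=.
      ring.
    move=> i /andP[/negPf ix /negPf iy].
    by rewrite /e /comb /dx /dy /basis_vector ix iy /=; ring.
  rewrite -(sos_rotated_sextic_slice zw sosf ez ew e1 j) /e !trilin_comb.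
  by rewrite /L -/(T j); ring.
exists (fun i => dx i +i* dy i) => [|j].
  by exists x; rewrite eq_complex /= /dx /basis_vector eqxx oner_eq0.
(* Two axis directions determine the linear form of the r z^2 coefficients, and
   two rational directions suffice to compare the remaining coefficients. *)
have xdir := slice 1 0 ltac:(ring) j.
have ydir := slice 0 1 ltac:(ring) j.
have plus := slice (3 / 5) (4 / 5) ltac:(field) j.
have minus := slice (3 / 5) (- (4 / 5)) ltac:(field) j.
rewrite def_p meval_cubic_form_complex -/(T j).
by apply/eqP; rewrite eq_complex /=; apply/andP; split; apply/eqP; lra.
Qed.

Theorem theorem1p6 (R : realType) (n : nat) (hn : (4 <= n)%N) :
  exists f : {mpoly R[n]}, [/\ Sigma 6 f, positive_definite f & noncoercive f].
Proof.
case: n hn => [|[|[|[|n]]]] // _.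
exists (rotated_sextic R (inord 0) (inord 1)); split.
- split; first exact: rotated_sextic_homog.
  by exists n.+4, (fun i => 'X_i * factor R (inord 0) (inord 1) i).
- apply: rotated_sextic_positive_definite.
  by rewrite -val_eqE /= !inordK.
- apply: (@rotated_sextic_noncoercive _ _ _ _ (inord 2) (inord 3)).
  by rewrite /= !inE -!val_eqE /= !inordK.
Qed.
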